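(* For all $k\in\mathbb{N}$, $$41\,k\;\le\;24\,p_T(k)+72,\qquad\text{i.e.}\qquad p_T(k)\ \ge\ \tfrac{41}{24}\,k-3 .$$
   Context: For $n\in\mathbb{N}=\{0,1,2,\dots\}$ let $m_n\in\mathbb{Z}$ be the nearest integer to $(3/2)^n$, with half-integers rounded up, so that $(3/2)^n-m_n\in[-\tfrac12,\tfrac12)$. The steering letter is $t_n=2m_{n+1}-3m_n\in\{-2,-1,0,1,2\}$, and the steering word is the infinite word $T=(t_n)_{n\ge0}$. The subword complexity $p_T(k)$ is the number of distinct length-$k$ factors of $T$, i.e. the number of distinct blocks $(t_a,t_{a+1},\dots,t_{a+k-1})$ with $a\in\mathbb{N}$. *)

(* Defs.v *)
From mathcomp Require Import all_boot all_order all_algebra.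
From mathcomp Require Import finmap boolp classical_sets functions cardinality.
From mathcomp Require Import ring lra zify.
Set Implicit Arguments.
Unset Strict Implicit.
Unset Printing Implicit Defensive.
Import Order.TTheory GRing.Theory Num.Theory.
Local Open Scope ring_scope.
Local Open Scope classical_set_scope.

(* Rounding half-integers up amounts to taking the floor of x + 1/2; see
   [near32_itv]. *)
Definition near32 (n : nat) : int :=
  Num.floor ((3 / 2 : rat) ^+ n + 1 / 2).

Definition steering (n : nat) : int := 2 * near32 n.+1 - 3 * near32 n.

Definition factor (A : Type) (w : nat -> A) (k a : nat) : seq A :=
  mkseq (fun i => w (a + i)%N) k.

Definition factors (A : Type) (w : nat -> A) (k : nat) : set (seq A) :=
  range (factor w k).

(* [fset_set] returns the empty finite set on an infinite set, so this is
   meaningful only for words whose sets of factors are finite; for the steering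
   word this is [finite_factors_steering]. *)
Definition complexity (A : choiceType) (w : nat -> A) (k : nat) : nat :=
  #|` fset_set (factors w k)|%fset.

Lemma near32_itv n :
  - (1 / 2) <= (3 / 2 : rat) ^+ n - (near32 n)%:~R < 1 / 2.
Proof.
have := floor_itv ((3 / 2 : rat) ^+ n + 1 / 2).
rewrite -/(near32 n) intrD => /andP[h1 h2]; apply/andP; split; lra.
Qed.

Lemma steering_bound n : -2 <= steering n <= 2.
Proof.
have /andP[a1 a2] := near32_itv n; have /andP[b1 b2] := near32_itv n.+1.
rewrite exprS in b1 b2.
have h : -3 < (steering n)%:~R :> rat /\ (steering n)%:~R < 3 :> rat.
  rewrite /steering intrB !intrM; split; lra.
case: h => h1 h2.
have {}h1 : -3 < steering n by rewrite -(ltr_int rat).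
have {}h2 : steering n < 3 by rewrite -(ltr_int rat).
by lia.
Qed.

Lemma finite_factors_steering k : finite_set (factors steering k).
Proof.
pose g (u : k.-tuple 'I_5) : seq int := [seq (val i)%:Z - 2 | i : 'I_5 <- u].
apply: (@sub_finite_set _ _ (range g)); last exact/finite_image/finite_finset.
move=> _ [a _ <-].
exists [tuple (inord (absz (steering (a + i)%N + 2)) : 'I_5) | i < k] => //.
apply: (@eq_from_nth _ 0) => [|i]; rewrite size_map size_tuple.
  by rewrite size_mkseq.
move=> ik; rewrite (nth_map ord0) ?size_tuple// nth_mkseq//.
have -> : i = Ordinal ik by [].
rewrite -tnth_nth tnth_mktuple /=.
by have := steering_bound (a + i); move=> h; rewrite inordK; lia.
Qed.

(* Main.v *)
Require Import Defs.
From mathcomp Require Import all_boot all_order all_algebra.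
From mathcomp Require Import finmap classical_sets cardinality.
From mathcomp Require Import lra zify.
Set Implicit Arguments.
Unset Strict Implicit.
Unset Printing Implicit Defensive.
Import Order.TTheory GRing.Theory Num.Theory.
Local Open Scope ring_scope.

(* If the length-k blocks at positions a < b agree, then the recursion
   2 m_{n+1} = 3 m_n + t_n gives 2^k (m_{b+k} - m_{a+k}) = 3^k (m_b - m_a), so
   2^k divides m_b - m_a. For 2 <= a < b this difference is positive and smaller
   than (3/2)^b, which is at most 2^k as long as 24 b <= 41 k because
   (3/2)^41 <= 2^24. So the blocks at positions 2 <= a <= 41 k / 24 are
   pairwise distinct. *)

Lemma complexity_ge (A : choiceType) (w : nat -> A) (k a n : nat) :
    finite_set (factors w k) ->
    {in iota a n &, injective (factor w k)} ->
  (n <= complexity w k)%N.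
Proof.
move=> fin inj; rewrite -(size_iota a n) -(size_map (factor w k)).
apply: uniq_leq_size; first by rewrite map_inj_in_uniq// iota_uniq.
by move=> _ /mapP[i _ ->]; rewrite in_fset_set// inE; exists i.
Qed.

Lemma factor_eq_steering_diff (k a b : nat) :
    factor steering k a = factor steering k b ->
  2 ^+ k * (near32 (b + k) - near32 (a + k)) = 3 ^+ k * (near32 b - near32 a).
Proof.
move=> eqf.
have eqt i : (i < k)%N -> steering (a + i) = steering (b + i).
  by move=> ik; have := congr1 (nth 0 ^~ i) eqf; rewrite !nth_mkseq.
suff : forall n, (n <= k)%N ->
    2 ^+ n * (near32 (b + n) - near32 (a + n)) = 3 ^+ n * (near32 b - near32 a).
  exact.
elim=> [_|n IHn nk]; first by rewrite !addn0.
(* Equal letters cancel when the two recursions are subtracted, so each step multiplies the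
   difference by exactly 3/2. *)
have := eqt n nk; rewrite /steering -!addnS => eqn.
by have := IHn (ltnW nk); rewrite !exprS; nia.
Qed.

Lemma factor_eq_steering_dvd (k a b : nat) :
    factor steering k a = factor steering k b ->
  (2 ^+ k %| near32 b - near32 a)%Z.
Proof.
move=> /factor_eq_steering_diff eqd.
have cop : coprimez (2 ^+ k) (3 ^+ k).
  by rewrite coprimezXl ?coprimezXr.
by rewrite -(Gauss_dvdzr _ cop) -eqd dvdz_mulr.
Qed.

Lemma leq_expr32 (a b : nat) : (a <= b)%N -> (3 / 2 : rat) ^+ a <= (3 / 2) ^+ b.
Proof. by apply: ler_weXn2l; lra. Qed.

(** The gap [(3/2)^b - (3/2)^a] is at least [(3/2)^a / 2 >= 9/8], more than the two rounding errors
    together. The bound 2 on [a] is sharp, as [near32 1 = near32 2 = 2]. *)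
Lemma near32_sub_gt0 (a b : nat) : (2 <= a < b)%N -> 0 < near32 b - near32 a.
Proof.
move=> /andP[a2 ab].
have /andP[a_ge _] := near32_itv a; have /andP[_ b_lt] := near32_itv b.
have xa : (3 / 2 : rat) ^+ 2 <= (3 / 2) ^+ a by apply: leq_expr32.
have xb : (3 / 2 : rat) ^+ a.+1 <= (3 / 2) ^+ b by apply: leq_expr32.
by rewrite exprS in xb; rewrite -(ltr_int rat) intrB; lra.
Qed.

(** Since [near32 a > 9/4 - 1/2], subtracting it outweighs the rounding error of at most 1/2 in
    [near32 b]. *)
Lemma near32_sub_lt (a b : nat) : (2 <= a)%N ->
  (near32 b - near32 a)%:~R < (3 / 2 : rat) ^+ b.
Proof.
move=> a2.
have /andP[_ a_lt] := near32_itv a; have /andP[b_ge _] := near32_itv b.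
have xa : (3 / 2 : rat) ^+ 2 <= (3 / 2) ^+ a by apply: leq_expr32.
by rewrite intrB; lra.
Qed.

(** Compare [q]-th powers: [x^(q b) <= x^(p k) <= y^(q k)]. *)
Lemma ler_expr_slope (R : realDomainType) (x y : R) (p q b k : nat) :
    1 <= x -> 0 <= y -> (0 < q)%N -> x ^+ p <= y ^+ q -> (q * b <= p * k)%N ->
  x ^+ b <= y ^+ k.
Proof.
move=> x1 y0 q0 xy bk; have x0 := le_trans ler01 x1.
rewrite -(ler_pXn2r q0) ?nnegrE ?exprn_ge0// -!exprM mulnC.
apply: le_trans (ler_weXn2l x1 bk) _.
by rewrite exprM mulnC exprM lerXn2r ?nnegrE ?exprn_ge0.
Qed.

(** The slope 41/24 = 1.7083... is a continued-fraction convergent, from below, of the optimal slope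
    [log 2 / log (3/2)] = 1.7095... *)
Lemma expr32_le_expr2 (b k : nat) : (24 * b <= 41 * k)%N ->
  (3 / 2 : rat) ^+ b <= 2 ^+ k.
Proof. by apply: (@ler_expr_slope _ _ _ 41 24); [lra | lra | | lra]. Qed.

Lemma factor_steering_neq (k a b : nat) : (2 <= a < b)%N ->
  (24 * b <= 41 * k)%N -> factor steering k a <> factor steering k b.
Proof.
move=> ab bk /factor_eq_steering_dvd dvd.
have d_gt0 := near32_sub_gt0 ab.
have : near32 b - near32 a < 2 ^+ k.
  rewrite -(ltr_int rat) rmorphXn /=.
  apply: lt_le_trans (expr32_le_expr2 bk).
  by apply: near32_sub_lt; case/andP: ab.
apply/negP; rewrite -leNgt.
case/dvdzP: dvd d_gt0 => q ->.
have pow_gt0 : 0 < 2 ^+ k :> int by rewrite exprn_gt0.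
by rewrite pmulr_lgt0// => q_gt0; rewrite ler_peMl// ltW.
Qed.

Theorem theorem2p10 (k : nat) : (41 * k <= 24 * complexity steering k + 72)%N.
Proof.
(* This counts the positions from 2 to [(41 * k) %/ 24]. After multiplication by 24, the floor costs
   at most 23 and the subtracted 1 costs 24, which 72 covers. *)
have : ((41 * k) %/ 24 - 1 <= complexity steering k)%N; last by lia.
apply: (@complexity_ge _ _ _ 2); first exact: finite_factors_steering.
move=> i j; rewrite !mem_iota => ilt jlt eqf.
case: (ltngtP i j) => // ij; exfalso.
- by apply: (@factor_steering_neq k i j) eqf; lia.
- by apply: (@factor_steering_neq k j i) (esym eqf); lia.
Qed.
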